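(* For every finite group $\mathfrak{G}$ and every $d \in \{8,12,16,20,24\}$ there exist infinitely many pairwise non-isomorphic finite $d$-regular nut graphs $G$ such that $\mathrm{Aut}(G) \cong \mathfrak{G}$.
   Context: All graphs are finite, simple and connected. For a graph $G$, $\mathbf{A}(G)$ denotes its adjacency matrix and the nullity $\eta(G)$ is the dimension of the kernel of $\mathbf{A}(G)$. A nut graph is a simple graph of order at least 2 with $\eta(G)=1$ such that a (equivalently every) non-zero vector $\mathbf{x}=[x_1,\dots,x_n]^\intercal \in \ker \mathbf{A}(G)$ is full, i.e. $x_i \neq 0$ for all $i$. A graph is $d$-regular if every vertex has degree $d$. $\mathrm{Aut}(G)$ is the full automorphism group of $G$. *)

(* Defs.v *)
From HB Require Import structures.
From mathcomp Require Import all_boot all_order all_algebra all_fingroup.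
From mathcomp Require Import reals.

Set Implicit Arguments.
Unset Strict Implicit.
Unset Printing Implicit Defensive.

Import GRing.Theory.
Local Open Scope ring_scope.

Record sgraph := SGraph {
  vertex : finType;
  adj : rel vertex;
  adj_sym : symmetric adj;
  adj_irr : irreflexive adj
}.

Definition connected_graph (G : sgraph) : Prop :=
  forall x y : vertex G, connect (@adj G) x y.

Definition degree (G : sgraph) (x : vertex G) : nat := #|[set y | adj x y]|.

Definition regular_graph (d : nat) (G : sgraph) : Prop :=
  forall x : vertex G, degree x = d.

Definition graph_iso (G H : sgraph) : Prop :=
  exists f : vertex G -> vertex H,
    bijective f /\ forall x y, adj (f x) (f y) = adj x y.

Definition graph_aut (G : sgraph) : {set {perm vertex G}} :=
  [set s : {perm vertex G} | [forall x, forall y, adj (s x) (s y) == adj x y]].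

Lemma graph_autP (G : sgraph) (s : {perm vertex G}) :
  reflect (forall x y, adj (s x) (s y) = adj x y) (s \in graph_aut G).
Proof.
rewrite inE; apply: (iffP forallP) => [h x y | h x].
  by move/forallP: (h x) => /(_ y) /eqP.
by apply/forallP => y; rewrite h.
Qed.

Lemma graph_aut_group_set (G : sgraph) : group_set (graph_aut G).
Proof.
apply/group_setP; split => [|s t /graph_autP hs /graph_autP ht]; apply/graph_autP => x y.
  by rewrite !perm1.
by rewrite !permM ht hs.
Qed.

Canonical graph_aut_group (G : sgraph) : {group {perm vertex G}} :=
  Group (graph_aut_group_set G).

Section Spectral.
Variables (F : fieldType) (G : sgraph).

(* Rows and columns follow the library's enumeration of the vertices. *)
Definition adjmx : 'M[F]_#|vertex G| :=
  \matrix_(i, j) (adj (enum_val i) (enum_val j))%:R.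

Definition adj_ker : {vspace 'cV[F]_#|vertex G|} :=
  lker (linfun (mulmx adjmx : 'cV[F]_#|vertex G| -> 'cV[F]_#|vertex G|)).

Definition nullity : nat := \dim adj_ker.

Definition full_vector n (x : 'cV[F]_n) : Prop := forall i, x i 0 != 0.

Definition nut_graph : Prop :=
  [/\ (2 <= #|vertex G|)%N,
      nullity = 1%N
    & forall x, x \in adj_ker -> x != 0 -> full_vector x].

Lemma mem_adj_ker (x : 'cV[F]_#|vertex G|) :
  (x \in adj_ker) = (adjmx *m x == 0).
Proof. by rewrite memv_ker lfunE. Qed.

End Spectral.

(* Main.v *)
Require Import Defs.
From HB Require Import structures.
From mathcomp Require Import all_boot all_order all_algebra all_fingroup.
From mathcomp Require Import reals.
From mathcomp Require Import zify ring lra.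

(* Let [d = 4 t] with [t >= 2].  Start from a connected 4-regular graph on a set of
   roots and attach to every root a gadget on [4 t + 3] vertices through [4 t - 4]
   ports.  The adjacency matrix of the gadget is invertible, and with value 1 at the
   root the kernel equations inside the gadget force the values 1 and -1 at odd and
   even positions, which sum to -4 over the ports.  The kernel equation at a root
   then says that the values on the roots are harmonic, hence constant by the
   maximum principle: the graph is a nut graph.

   Edges inside gadgets are exactly the edges with at least [4 t - 4] common
   neighbours, so automorphisms preserve roots and gadgets.  They fix the kernel
   vector, hence preserve parity inside the gadgets, which makes the gadgets rigid
   and the two kinds of gadgets distinguishable.  Automorphisms are therefore the
   automorphisms of the root graph preserving a 2-colouring of the roots.

   The root graph is the voltage cover, with fibre the given group, of the circulant
   graph on Z/q with steps 1 (trivial voltage) and 2 (voltages running through the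
   whole group).  The colouring marks 3, 4 and 6 in Z/q; it identifies the Z/q
   coordinate of every root, and what remains are the left translations. *)

Set Implicit Arguments.
Unset Strict Implicit.
Unset Printing Implicit Defensive.

Import Order.TTheory GRing.Theory Num.Theory.

(** * Linear recurrences on a ladder *)

Section Ladder.

Local Open Scope ring_scope.

Variables (R : realFieldType) (r : nat) (x y : nat -> R).
Hypothesis recx : forall k, (0 < k <= r.*2)%N -> x k.-1 + x k + x k.+1 + y k = 0.
Hypothesis recy : forall k, (0 < k <= r.*2)%N -> y k.-1 + y k + y k.+1 + x k = 0.

(* The sum [x + y] is [(-1)^k] times an affine function of [k], the difference
   [x - y] satisfies [D (k + 2) = - D k]. *)
Lemma ladder_sum (A B : R) (j : nat) :
    x 0 = y 0 -> A = x 0 + y 0 -> B = - (x 1 + y 1) - A -> (j <= r)%N ->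
  [/\ x j.*2 = y j.*2, x j.*2 + y j.*2 = A + j.*2%:R * B
    & x j.*2.+1 + y j.*2.+1 = - (A + j.*2.+1%:R * B)].
Proof.
move=> e0 eA eB; elim: j => [_|j IH jr].
  by rewrite double0; split; rewrite ?mul0r ?addr0 ?mul1r //; lra.
have [|e1 e2 e3] := IH; first lia.
have hx := @recx j.*2.+1 ltac:(lia); have hy := @recy j.*2.+1 ltac:(lia).
have hx' := @recx j.*2.+2 ltac:(lia); have hy' := @recy j.*2.+2 ltac:(lia).
rewrite doubleS -[j.*2.+3%:R]natr1 -[j.*2.+2%:R]natr1 -[j.*2.+1%:R]natr1.
move: e3; rewrite -natr1 /= in hx hy hx' hy' * => e3.
split; lra.
Qed.

(** Each recurrence gives the value at [k.-1] from values at [k] and [k.+1], so zeros on the last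
    two rungs propagate backwards. *)
Lemma ladder_zero :
    x r.*2 = 0 -> y r.*2 = 0 -> x r.*2.+1 = 0 -> y r.*2.+1 = 0 ->
  forall k, (k <= r.*2.+1)%N -> x k = 0 /\ y k = 0.
Proof.
move=> x0 y0 x1 y1 k hk.
suff H j : (j <= r.*2)%N -> [/\ x (r.*2 - j)%N = 0, y (r.*2 - j)%N = 0,
    x (r.*2 - j).+1 = 0 & y (r.*2 - j).+1 = 0].
  case: (posnP k) => [->|k0].
    by have [|a b _ _] := H r.*2 => //; rewrite subnn in a b.
  have [|_ _] := H (r.*2.+1 - k)%N; first lia.
  by have -> : (r.*2 - (r.*2.+1 - k)).+1 = k by lia.
elim: j => [_|j IH jr]; first by rewrite subn0.
have [|a b c e] := IH; first lia.
have E : (r.*2 - j)%N = (r.*2 - j.+1).+1 by lia.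
have hx := @recx (r.*2 - j)%N ltac:(lia); have hy := @recy (r.*2 - j)%N ltac:(lia).
rewrite E in a b c e hx hy; rewrite /= in hx hy.
by split => //; lra.
Qed.

End Ladder.

(** * The gadgets *)

Section Gadget.

Variable t : nat.
Hypothesis t_gt1 : 1 < t.

(* The complement of the gadget of colour [c] is the path 0, 1, ..., 4 t + 2 with the
   chords [a -- mate c a]; unmatched positions are their own mates.  The chords
   [a -- 4 t + 8 - a] fold the path into a ladder around [2 t + 4]. *)
Definition tip (c : bool) : nat := if c then 4 else 6.

Definition mate (c : bool) (a : nat) : nat :=
  if a == 0 then tip c else if a == tip c then 0
  else if a == tip (~~ c) then (2 * t + 4)
  else if a == (2 * t + 4) then tip (~~ c)
  else if a == 2 then (4 * t + 2) else if a == (4 * t + 2) then 2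
  else if (8 <= a <= 4 * t) then (4 * t + 8 - a) else a.

Definition cogadget (c : bool) (a a' : nat) : bool :=
  (a != a') && [|| a' == a.+1, a == a'.+1 | a' == mate c a].

Definition gadget (c : bool) (a a' : nat) : bool :=
  (a != a') && ~~ cogadget c a a'.

Definition ports (a : nat) : bool :=
  a \notin [:: 0; 1; 3; 5; 7; (4 * t + 1); (4 * t + 2)].

Lemma mate_lt c a : (a < (4 * t).+3) -> (mate c a < (4 * t).+3).
Proof. rewrite /mate /tip; case: c => /=; do !case: ifP => /=; lia. Qed.

Lemma mateK c a : (a < (4 * t).+3) -> mate c (mate c a) = a.
Proof. rewrite /mate /tip; case: c => /=; do !case: ifP => /=; lia. Qed.

(** Chords preserve parity while path edges change it; the parity arguments on gadgets rest on
    this. *)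
Lemma odd_mate c a : odd (mate c a) = odd a.
Proof.
rewrite /mate /tip; case: c => /=; do !case: ifP => /=; lia.
Qed.

Lemma mate_eq c a : (a < (4 * t).+3) ->
  (mate c a == a) = (a \in [:: 1; 3; 5; 7; (4 * t + 1)]).
Proof. rewrite /mate /tip !inE; case: c => /=; do !case: ifP => /=; lia. Qed.

Lemma mate_mirror c k : (0 < k <= 2 * t - 4) ->
  mate c (2 * t + 4 - k) = (2 * t + 4 + k) /\
  mate c (2 * t + 4 + k) = (2 * t + 4 - k).
Proof.
by move=> hk; split; rewrite /mate /tip; case: c => /=; do !case: ifP => /=; lia.
Qed.

Lemma mate_special c :
  [/\ mate c 0 = tip c, mate c 1 = 1, mate c 2 = (4 * t + 2) & mate c 3 = 3]
  /\ [/\ mate c (tip c) = 0, mate c (tip (~~ c)) = (2 * t + 4), mate c 5 = 5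
       & mate c 7 = 7]
  /\ [/\ mate c (2 * t + 4) = tip (~~ c), mate c (4 * t + 1) = (4 * t + 1)
       & mate c (4 * t + 2) = 2].
Proof.
by (split; [|split]); split; rewrite /mate /tip; case: c => /=; do ?case: ifP => /=; lia.
Qed.

(* Sum of [u] over the closed neighbourhood of [a] in the complement. *)
Definition closed_sum (R : nmodType) (c : bool) (u : nat -> R) (a : nat) : R :=
  (u a + (if (0 < a)%N then u a.-1 else 0)
  + (if (a < 4 * t + 2)%N then u a.+1 else 0)
  + (if mate c a == a then 0 else u (mate c a)))%R.

(** The ladder recurrences express the sums over the last rungs through two parameters [A] and [B];
    the equations off the ladder then leave only the zero solution. *)
Lemma closed_sum_inj (R : realFieldType) c (u : nat -> R) :
    (forall a, a < (4 * t).+3 -> closed_sum c u a = 0%R) ->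
  forall a, a < (4 * t).+3 -> u a = 0%R.
Proof.
move=> H.
have inner a : 0 < a < 4 * t + 2 ->
    (u a + u a.-1 + u a.+1 + (if mate c a == a then 0 else u (mate c a)) = 0)%R.
  move=> /andP[a0 ab]; have := H a ltac:(lia).
  by rewrite /closed_sum a0 ab.
(* The path is folded at its centre [2 * t + 4]: [x] runs down to 7 and [y] up to [4 * t + 1], the
   mirror chords being the rungs. *)
pose r := t - 2; pose x k := u (2 * t + 4 - k); pose y k := u (2 * t + 4 + k).
have hx k : 0 < k <= r.*2 -> (x k.-1 + x k + x k.+1 + y k = 0)%R.
  rewrite /r => hk; have := inner (2 * t + 4 - k) ltac:(lia).
  have [-> _] := @mate_mirror c k ltac:(lia).
  have -> : (2 * t + 4 + k == 2 * t + 4 - k) = false by lia.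
  have -> : (2 * t + 4 - k).-1 = 2 * t + 4 - k.+1 by lia.
  have -> : (2 * t + 4 - k).+1 = 2 * t + 4 - k.-1 by lia.
  rewrite -/(x k) -/(y k) -/(x k.-1) -/(x k.+1); lra.
have hy k : 0 < k <= r.*2 -> (y k.-1 + y k + y k.+1 + x k = 0)%R.
  rewrite /r => hk; have := inner (2 * t + 4 + k) ltac:(lia).
  have [_ ->] := @mate_mirror c k ltac:(lia).
  have -> : (2 * t + 4 - k == 2 * t + 4 + k) = false by lia.
  have -> : (2 * t + 4 + k).-1 = 2 * t + 4 + k.-1 by lia.
  have -> : (2 * t + 4 + k).+1 = 2 * t + 4 + k.+1 by lia.
  rewrite -/(x k) -/(y k) -/(y k.-1) -/(y k.+1); lra.
have xy0 : x 0 = y 0 by rewrite /x /y subn0 addn0.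
have [e8 s8 s7] := ladder_sum hx hy xy0 erefl erefl (leqnn r).
(* Only positions 0 to 6 and [4 * t + 2] lie off the ladder, and zeros at its end clear the ladder
   itself. *)
suff [] : [/\ x r.*2 = 0, y r.*2 = 0, x r.*2.+1 = 0, y r.*2.+1 = 0
    & [/\ u 0%N = 0, u 1%N = 0, u 2%N = 0 & u 3%N = 0] /\
      [/\ u 4%N = 0, u 5%N = 0, u 6%N = 0 & u (4 * t + 2)%N = 0]]%R.
  move=> z8 w8 x1 y1 [[u0 u1 u2 u3] [u4 u5 u6 ue]] a ab.
  have Z := ladder_zero hx hy z8 w8 x1 y1.
  have [a7|a7] := ltnP a 7; first by case: a ab a7 => [|[|[|[|[|[|[|a]]]]]]].
  have [->//|ae] := eqVneq a (4 * t + 2).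
  have [ac|ac] := leqP a (2 * t + 4).
    have -> : a = 2 * t + 4 - (2 * t + 4 - a) by lia.
    by have [] := Z (2 * t + 4 - a) ltac:(lia).
  have -> : a = 2 * t + 4 + (a - (2 * t + 4)) by lia.
  by have [] := Z (a - (2 * t + 4)) ltac:(lia).
have [] : [/\ x 0 = u (2 * t + 4), x r.*2 = u 8, y r.*2 = u (4 * t),
    x r.*2.+1 = u 7 & y r.*2.+1 = u (4 * t + 1)].
  by rewrite /x /y /r; split; congr u; lia.
move: s8 s7; rewrite -natr1.
set A := (x 0 + y 0)%R; set B := (- _ - A)%R; move: (r.*2%:R)%R (ler0n R r.*2) => P P0.
have eB : (x 1%N + y 1%N = - A - B)%R by rewrite /B; lra.
have eA : (A = x 0%N + y 0%N)%R by [].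
move: A B eA eB => A B eA eB s8 s7 ux0 ux8 uy8 ux7 uy7.
have q0 := H 0 ltac:(lia); have q1 := inner 1 ltac:(lia).
have q2 := inner 2 ltac:(lia); have q3 := inner 3 ltac:(lia).
have q4 := inner 4 ltac:(lia); have q5 := inner 5 ltac:(lia).
have q6 := inner 6 ltac:(lia); have q7 := inner 7 ltac:(lia).
have p1 := inner (4 * t + 1) ltac:(lia); have p2 := H (4 * t + 2) ltac:(lia).
have pc := inner (2 * t + 4) ltac:(lia).
have up1 : u (2 * t + 4).+1 = y 1 by congr u; lia.
have um1 : u (2 * t + 4).-1 = x 1 by congr u; lia.
have uE : u (4 * t + 1).+1 = u (4 * t + 2) by congr u; lia.
have uE' : u (4 * t + 2).-1 = u (4 * t + 1) by congr u; lia.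
have uE1 : u (4 * t + 1).-1 = u (4 * t) by congr u; lia.
have [[m0 m1 m2 m3] [[mt mt' m5 m7] [mc me1 me2]]] := mate_special c.
move: q0; rewrite /closed_sum m0 ltnn addr0 (_ : 0 < 4 * t + 2); last lia.
rewrite (_ : (tip c == 0) = false) => [q0|]; last by case: (c).
rewrite m1 eqxx /= in q1; rewrite m3 eqxx /= in q3.
move: q2; rewrite m2 (_ : (4 * t + 2 == 2) = false) /= => [q2|]; last lia.
rewrite m5 eqxx /= in q5; rewrite m7 eqxx /= in q7.
move: pc; rewrite mc up1 um1 (_ : (tip (~~ c) == 2 * t + 4) = false) => [pc|];
  last by case: (c); rewrite /=; lia.
rewrite me1 eqxx uE uE1 in p1.
move: p2; rewrite /closed_sum me2 uE' ltnn (_ : 0 < 4 * t + 2); last lia.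
rewrite (_ : (2 == 4 * t + 2) = false) => [p2|]; last lia.
rewrite /= in q4 q6.
have {q4 q6} [q4 q6] : (u 4%N + u 3%N + u 5%N + (if c then u 0%N else u (2 * t + 4)%N) = 0
    /\ u 6%N + u 5%N + u 7%N + (if c then u (2 * t + 4)%N else u 0%N) = 0)%R.
  clear -q4 q6 mt mt' t_gt1; case: c mt mt' q4 q6; rewrite /tip /= => -> ->.
    by rewrite (_ : (2 * t + 4 == 6) = false); [|lia].
  by rewrite (_ : (2 * t + 4 == 4) = false); [|lia].
rewrite ux7 uy7 in s7 *; rewrite ux8 uy8 in s8 e8 *.
rewrite -xy0 ux0 in eA; rewrite -addrA -addrA [in X in (_ + X)%R]addrA eB in pc.
clear -P0 eA s8 s7 e8 q0 q1 q2 q3 q4 q5 q6 q7 p1 p2 pc.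
(* Elimination leaves [B] with the coefficient [P + 2], nonzero because [P] is the image of the
   natural number [r.*2]. *)
have B0 : ((P + 2) * B = 0)%R by case: c q0 q4 q6 pc => /= q0 q4 q6 pc; lra.
have {}B0 : (B = 0)%R.
  by move/eqP: B0; rewrite mulf_eq0 => /orP[/eqP|/eqP //]; lra.
rewrite B0 in s7 s8 pc; case: c q0 q4 q6 pc => /= q0 q4 q6 pc.
  by do ![split]; lra.
by do ![split]; lra.
Qed.

End Gadget.

(** * Sums over gadget neighbourhoods and ports *)

Lemma big_ord_pick (V : nmodType) n (f : nat -> V) k :
  (\sum_(i < n) (if i == k :> nat then f i else 0) = if (k < n)%N then f k else 0)%R.
Proof.
rewrite -big_mkcond /=; case: ltnP => kn; last first.
  by rewrite big1 // => i /eqP e; have := ltn_ord i; rewrite e ltnNge kn.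
by rewrite (big_pred1 (Ordinal kn)).
Qed.

Lemma if_exclusive4 (V : nmodType) (z : V) (p1 p2 p3 p4 : bool) :
    p1 + p2 + p3 + p4 <= 1 ->
  ((if [|| p1, p2, p3 | p4] then z else 0) =
   (if p1 then z else 0) + (if p2 then z else 0)
   + (if p3 then z else 0) + (if p4 then z else 0))%R.
Proof. by case: p1; case: p2; case: p3; case: p4 => //; rewrite ?addr0 ?add0r. Qed.

Section GadgetSums.

Variable t : nat.
Hypothesis t_gt1 : 1 < t.

(** The gadget matrix is the all-ones matrix minus the closed neighbourhood matrix of the
    complement. *)
Lemma gadget_sum (V : zmodType) c (f : nat -> V) a : a < (4 * t).+3 ->
  (\sum_(i < (4 * t).+3 | gadget t c a i) f i
     = \sum_(i < (4 * t).+3) f i - closed_sum t c f a)%R.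
Proof.
move=> ab; apply/eqP; rewrite eq_sym subr_eq; apply/eqP.
rewrite (bigID (fun i : 'I_(4 * t).+3 => gadget t c a i)) /=; congr (_ + _)%R.
rewrite big_mkcond /=.
transitivity (\sum_(i < (4 * t).+3)
   ((if i == a :> nat then f i else 0)
    + (if (0 < a)%N then (if i == a.-1 :> nat then f i else 0) else 0)
    + (if i == a.+1 :> nat then f i else 0)
    + (if mate t c a == a then 0 else if i == mate t c a :> nat then f i else 0)))%R.
  apply: eq_bigr => i _; have om := odd_mate t_gt1 c a.
  have -> : ~~ gadget t c a i = [|| i == a :> nat, (0 < a) && (i == a.-1 :> nat),
      i == a.+1 :> nat | (mate t c a != a) && (i == mate t c a :> nat)].
    rewrite /gadget /cogadget; lia.
  (* The alternatives exclude each other: the mate has the parity of [a], the path neighbours have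
     the other one. *)
  rewrite if_exclusive4; last by lia.
  by case: (0 < a); case: (mate t c a == a).
rewrite !big_split /= /closed_sum !big_ord_pick ab.
congr (_ + _ + _ + _)%R.
- case: ifP => a0; last by rewrite big1_eq.
  by rewrite big_ord_pick ifT //; lia.
- by rewrite (_ : (a.+1 < (4 * t).+3) = (a < 4 * t + 2)) //; lia.
- case: eqP => _; first by rewrite big1_eq.
  by rewrite big_ord_pick mate_lt.
Qed.

Lemma gadget_sym c a a' : a < (4 * t).+3 -> a' < (4 * t).+3 ->
  gadget t c a a' = gadget t c a' a.
Proof.
move=> ab ab'; rewrite /gadget /cogadget eq_sym; case: eqP => //= _.
have -> : (a == mate t c a') = (a' == mate t c a); last by rewrite orbCA.
by apply/eqP/eqP => ->; rewrite mateK.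
Qed.

(** Among even positions, an odd one misses only its path neighbours and an even one only itself and
    its mate; hence one of the ports 2, 4, 6 is adjacent. *)
Lemma port_nbr c a : exists2 k, k < (4 * t).+3 & ports t k && gadget t c a k.
Proof.
have : [|| gadget t c a 2, gadget t c a 4 | gadget t c a 6].
  have om := odd_mate t_gt1 c a; rewrite /gadget /cogadget; lia.
by case/or3P => h; [exists 2 | exists 4 | exists 6]; rewrite ?h ?andbT ?inE /ports ?inE; lia.
Qed.

Lemma sum_ports (V : zmodType) (f : nat -> V) :
  (\sum_(i < (4 * t).+3 | ports t i) f i
   = \sum_(i < (4 * t).+3) f i
     - \sum_(i <- [:: 0; 1; 3; 5; 7; 4 * t + 1; 4 * t + 2]%N) f i)%R.
Proof.
apply/eqP; rewrite eq_sym subr_eq; apply/eqP.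
rewrite (bigID (fun i : 'I_(4 * t).+3 => ports t i)) /=; congr (_ + _)%R.
rewrite (eq_bigl (fun i : 'I_(4 * t).+3 => (i : nat) \in [:: 0; 1; 3; 5; 7; 4 * t + 1; 4 * t + 2]));
  last by move=> i; rewrite negbK.
rewrite -(big_mkord (fun i => i \in [:: 0; 1; 3; 5; 7; 4 * t + 1; 4 * t + 2]) f).
rewrite -big_filter; apply: perm_big; apply: uniq_perm.
- by rewrite filter_uniq ?iota_uniq.
- by rewrite /= !inE; lia.
- by move=> i; rewrite mem_filter mem_index_iota !inE; lia.
Qed.

Definition parity_fun (V : Type) (p q : V) (a : nat) : V := if odd a then p else q.

Lemma sum_parity (V : zmodType) (p q : V) :
  (\sum_(i < (4 * t).+3) parity_fun p q i = p *+ (2 * t).+1 + q *+ (2 * t).+2)%R.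
Proof.
have -> : (4 * t).+3 = (2 * t).+1.*2.+1 by lia.
elim: (2 * t).+1 => [|n IH]; first by rewrite double0 big_ord1 mulr0n add0r.
rewrite doubleS big_ord_recr big_ord_recr /= IH /parity_fun /= odd_double /=.
by rewrite [(p *+ n.+1)%R]mulrSr [(q *+ n.+2)%R]mulrSr -addrA addrACA.
Qed.

End GadgetSums.

(** * Degrees, invertibility and rigidity of gadgets *)

Section GadgetKernel.

Variable t : nat.
Hypothesis t_gt1 : 1 < t.

(** The non-ports are the unmatched positions, all odd, and the two ends of the path, both even. A
    port thus has one more odd term than a non-port: its mate if it is odd, a second path neighbour
    if it is even. *)
Lemma closed_sum_parity (V : comNzRingType) c (p q : V) a : a < (4 * t).+3 ->
  (closed_sum t c (parity_fun p q) a = q *+ 2 + p *+ (ports t a).+1)%R.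
Proof.
move=> ab; rewrite /closed_sum mate_eq // {4}/parity_fun odd_mate //.
have pE : ports t a = (0 < a < 4 * t + 2) && (a \notin [:: 1; 3; 5; 7; 4 * t + 1]).
  by rewrite /ports !inE; lia.
have [oa|ea] := boolP (odd a).
  have [a0 ae] : 0 < a /\ a < 4 * t + 2 by lia.
  have [op os] : odd a.-1 = false /\ odd a.+1 = false by lia.
  rewrite pE /parity_fun a0 ae oa op os /=.
  by case: ifP => _ /=; ring.
have aN : (a \in [:: 1; 3; 5; 7; 4 * t + 1]) = false by rewrite !inE; lia.
rewrite pE aN andbT {1}/parity_fun (negbTE ea) /=.
have [->|a0] := posnP a; first by rewrite /parity_fun (_ : 0 < 4 * t + 2) /=; [ring|lia].
have [op os] : odd a.-1 /\ odd a.+1 by lia.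
rewrite /parity_fun op os.
by case: ltnP => _ /=; ring.
Qed.

(** Cardinalities are computed in [int], where the subtractive formulas for sums apply. *)
Lemma sum_parity_one n (P : pred 'I_n) :
  (\sum_(i < n | P i) parity_fun 1 1 i = #|P|%:R :> int)%R.
Proof. by rewrite -sumr_const; apply: eq_bigr => i _; rewrite /parity_fun if_same. Qed.

(** Closed neighbourhoods in the complement have three elements, or four at a port, where the edge
    to the root compensates. *)
Lemma gadget_degree c a : a < (4 * t).+3 ->
  #|[pred i : 'I_(4 * t).+3 | gadget t c a i]| + ports t a = 4 * t.
Proof.
move=> ab; have := sum_parity_one [pred i : 'I_(4 * t).+3 | gadget t c a i].
rewrite [LHS](gadget_sum t_gt1 c _ ab) closed_sum_parity // [(\sum_(_ < _) _)%R](sum_parity t_gt1).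
rewrite !natz; move: #|_| => n; case: (ports t a); lia.
Qed.

Lemma card_ports : #|[pred i : 'I_(4 * t).+3 | ports t i]| + 4 = 4 * t.
Proof.
have := sum_parity_one [pred i : 'I_(4 * t).+3 | ports t i].
rewrite [LHS](sum_ports t_gt1) [(\sum_(_ < _) _)%R](sum_parity t_gt1).
rewrite !big_cons big_nil /parity_fun !if_same !natz; move: #|_| => n /=; lia.
Qed.

Definition sign (R : nzRingType) : nat -> R := parity_fun 1%R (-1)%R.

(** This is the kernel equation inside a gadget: at a port the root value 1 cancels the sum. *)
Lemma gadget_sign_sum (R : comNzRingType) c a : a < (4 * t).+3 ->
  (\sum_(i < (4 * t).+3 | gadget t c a i) sign R i = - (ports t a)%:R)%R.
Proof.
move=> ab; rewrite gadget_sum // closed_sum_parity // sum_parity //.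
by rewrite [in LHS]mulrSr; ring.
Qed.

(** All positions together give -1, and the seven non-ports give 5 - 2 = 3. *)
Lemma sum_ports_sign (R : comNzRingType) :
  (\sum_(i < (4 * t).+3 | ports t i) sign R i = - 4%:R)%R.
Proof.
rewrite sum_ports // sum_parity // !big_cons big_nil /sign /parity_fun /=.
have -> : odd (4 * t + 1) by lia.
have -> : odd (4 * t + 2) = false by lia.
by rewrite mulrS; ring.
Qed.

(** All closed sums of [u] equal its total [s], and so do those of [e], whence [u = e]. Summing over
    the [2 * t + 2] even positions gives [s = (t + 1) s], so [s = 0]. *)
Lemma gadget_injective (R : realFieldType) c (u : nat -> R) :
    (forall a, a < (4 * t).+3 -> (\sum_(i < (4 * t).+3 | gadget t c a i) u i = 0)%R) ->
  forall a, a < (4 * t).+3 -> u a = 0%R.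
Proof.
move=> H; pose s := (\sum_(i < (4 * t).+3) u i)%R.
pose e := parity_fun 0%R (s / 2)%R.
have ue a : a < (4 * t).+3 -> u a = e a.
  move=> ab; apply/eqP; rewrite -subr_eq0; apply/eqP; move: a ab.
  apply: (closed_sum_inj t_gt1 (c := c)) => a ab.
  have /eqP := H a ab; rewrite gadget_sum // subr_eq0 => /eqP cu.
  have ce : closed_sum t c e a = s by rewrite closed_sum_parity //; lra.
  have -> : closed_sum t c (fun a => u a - e a)%R a =
      (closed_sum t c u a - closed_sum t c e a)%R.
    by rewrite /closed_sum; do 3![case: ifP => _]; ring.
  by rewrite -cu ce subrr.
have : s = (\sum_(i < (4 * t).+3) e i)%R by apply: eq_bigr => i _; apply: ue.
rewrite sum_parity // mul0rn add0r -[(_ *+ (2 * t).+2)%R]mulr_natr => es.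
have s0 : (s = 0)%R.
  have : (s * t%:R = 0)%R.
    move: es; rewrite -[(2 * t).+2]addn2 natrD natrM; lra.
  by move/eqP; rewrite mulf_eq0 pnatr_eq0 => /orP[/eqP|]; [|lia].
by move=> a ab; rewrite ue // /e s0 mul0r /parity_fun if_same.
Qed.

Lemma gadget_path c a a' : odd a != odd a' ->
  gadget t c a a' = (a' != a.+1) && (a != a'.+1).
Proof. have := odd_mate t_gt1 c a; rewrite /gadget /cogadget; lia. Qed.

(* Opposite parity makes the path of the complement visible, and the two ends of
   the path are told apart by their mates, [tip c] and [2]. *)
Lemma gadget_rigid c c' (f : nat -> nat) :
    (forall a, a < (4 * t).+3 -> f a < (4 * t).+3) ->
    (forall a a', a < (4 * t).+3 -> a' < (4 * t).+3 -> f a = f a' -> a = a') ->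
    (forall a, a < (4 * t).+3 -> odd (f a) = odd a) ->
    (forall a, a < (4 * t).+3 -> ports t (f a) = ports t a) ->
    (forall a a', a < (4 * t).+3 -> a' < (4 * t).+3 ->
       gadget t c' (f a) (f a') = gadget t c a a') ->
  c = c' /\ forall a, a < (4 * t).+3 -> f a = a.
Proof.
move=> fb fI fo fp fg.
have step a : a.+1 < (4 * t).+3 -> f a.+1 = (f a).+1 \/ f a = (f a.+1).+1.
  move=> ab; have := fg a a.+1 ltac:(lia) ab.
  have := fo a ltac:(lia); have := fo a.+1 ab => o1 o2.
  rewrite !gadget_path; lia.
have mt0 : mate t c 0 = tip c /\ mate t c' 0 = tip c' by [].
have mte : mate t c' (4 * t + 2) = 2 by have [_ [_ []]] := mate_special t_gt1 c'.
(* The even non-ports are exactly the two ends of the path. *)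
have f0 : f 0 = 0 \/ f 0 = 4 * t + 2.
  have := fo 0 isT; have := fp 0 isT; have := fb 0 isT; rewrite /ports !inE; lia.
have tb : tip c < (4 * t).+3 by rewrite /tip; case: (c); lia.
have t0 : tip c = 4 \/ tip c = 6 by case: (c); [left|right].
have g0 : gadget t c 0 (tip c) = false.
  by rewrite /gadget /cogadget; have [-> _] := mt0; rewrite eqxx !orbT andbT andbN.
case: f0 => f0.
  have fE a : a < (4 * t).+3 -> f a = a.
    elim/ltn_ind: a => -[//|a] IH ab; have fa := IH a ltac:(lia) ltac:(lia).
    case: (step a ab) => [->|E]; first by rewrite fa.
    case: a IH ab fa E => [|a] IH ab fa E; first by rewrite f0 in E.
    have fa' := IH a ltac:(lia) ltac:(lia).
    have := fI a.+2 a ab ltac:(lia); lia.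
  split=> //; have := fg 0 (tip c) isT tb; rewrite !fE // g0.
  rewrite /gadget /cogadget; have [_ ->] := mt0.
  by case: (c) (c') => -[].
have fE a : a < (4 * t).+3 -> f a = 4 * t + 2 - a.
  elim/ltn_ind: a => -[_ _|a IH ab]; first by rewrite subn0.
  have fa := IH a ltac:(lia) ltac:(lia).
  case: (step a ab) => [E|]; last lia.
  case: a IH ab fa E => [|a] IH ab fa E; first by have := fb 1 ab; lia.
  have fa' := IH a ltac:(lia) ltac:(lia).
  have := fI a.+2 a ab ltac:(lia); lia.
(* Under reversal the non-neighbour [tip c] of 0 would go to 2, the mate of [4 * t + 2]; but [tip c]
   is at most 6, less than [4 * t]. *)
have := fg 0 (tip c) isT tb; rewrite !fE // subn0 g0.
rewrite /gadget /cogadget mte; lia.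
Qed.

End GadgetKernel.

(** * Nut graphs and kernel functions *)

Section KernelFunctions.

Variables (F : fieldType) (G : sgraph).
Local Open Scope ring_scope.

(** Indexing by vertices keeps the enumeration behind [adjmx] out of the later arguments. *)
Definition kernel_fun (f : vertex G -> F) : Prop :=
  forall v, \sum_(w | adj v w) f w = 0.

Lemma mem_adj_kerP (x : 'cV[F]_#|vertex G|) :
  reflect (kernel_fun (fun v => x (enum_rank v) 0)) (x \in adj_ker F G).
Proof.
have E v : \sum_(w | adj v w) x (enum_rank w) 0 = (adjmx F G *m x) (enum_rank v) 0.
  rewrite mxE [RHS](reindex (@enum_rank (vertex G))); last first.
    by apply: onW_bij; exists enum_val => i; rewrite ?enum_rankK ?enum_valK.
  rewrite big_mkcond; apply: eq_bigr => w _ /=.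
  by rewrite !mxE !enum_rankK; case: adj; rewrite ?mul1r ?mul0r.
rewrite mem_adj_ker; apply: (iffP eqP) => [x0 v | ker_x]; first by rewrite E x0 mxE.
apply/matrixP => i j; rewrite !ord1 -[i]enum_valK -E mxE; exact: ker_x.
Qed.

Lemma nut_graph_of_fun (x0 : vertex G -> F) :
    (2 <= #|vertex G|)%N -> kernel_fun x0 -> (forall v, x0 v != 0) ->
    (forall f, kernel_fun f -> exists c, forall v, f v = c * x0 v) ->
  nut_graph F G.
Proof.
move=> G2 kx0 x0nz kerE.
pose X0 : 'cV[F]_#|vertex G| := \col_i x0 (enum_val i).
have kerX x : x \in adj_ker F G -> exists c, x = c *: X0.
  move=> /mem_adj_kerP /kerE[c xE]; exists c; apply/matrixP => i j.
  by rewrite !ord1 !mxE -xE enum_valK.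
have X0ker : X0 \in adj_ker F G.
  apply/mem_adj_kerP => v; rewrite -[RHS](kx0 v).
  by apply: eq_bigr => w _; rewrite mxE enum_rankK.
have X0nz : X0 != 0.
  have /card_gt0P[v _] : (0 < #|vertex G|)%N by exact: leq_trans G2.
  apply/eqP => /matrixP/(_ (enum_rank v) 0)/eqP.
  by rewrite !mxE enum_rankK (negbTE (x0nz v)).
split=> //.
  have -> : nullity F G = \dim <[X0]>%VS; last by rewrite dim_vline X0nz.
  congr (\dim _); apply/eqP; rewrite eqEsubv; apply/andP; split.
    by apply/subvP => x /kerX[c ->]; rewrite memvZ ?memv_line.
  by rewrite -memvE.
move=> x /kerX[c ->]; rewrite scaler_eq0 negb_or => /andP[c0 _] i.
by rewrite !mxE mulf_neq0.
Qed.

End KernelFunctions.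

Lemma big_optionE (V : nmodType) (T : finType) (f : option T -> V) :
  (\sum_o f o = f None + \sum_a f (Some a))%R.
Proof.
rewrite (bigD1 None) //=; congr (_ + _)%R.
by rewrite (reindex_omap Some id) //= => [|[]//]; apply: eq_bigl => a; rewrite eqxx.
Qed.

Lemma big_pairE (V : nmodType) (A B : finType) (P : pred (A * B)) (f : A * B -> V) :
  (\sum_(v | P v) f v = \sum_a \sum_(b | P (a, b)) f (a, b))%R.
Proof. by rewrite pair_big_dep; apply: eq_big => -[a b]. Qed.

(** At a maximum the differences to the neighbours are nonnegative with sum zero, so the neighbours
    are maxima too; this spreads along paths. *)
Lemma harmonic_const (R : realFieldType) (W : finType) (e : rel W) k (f : W -> R) :
    (forall w, #|[set w' | e w w']| = k) ->
    (forall w, \sum_(w' | e w w') f w' = k%:R * f w)%R ->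
    (forall w w', connect e w w') ->
  forall w w', f w = f w'.
Proof.
move=> deg harm conn w1 w2.
have [w0 _ maxw0] := @Order.TotalTheory.arg_maxP _ _ _ w1 xpredT f isT.
suff E w : f w = f w0 by rewrite !E.
have /connectP[p] := conn w0 w; elim: p w0 maxw0 => [|z p IH] w0 maxw0 /=.
  by move=> _ ->.
case/andP => ez pz wE.
have fz : f z = f w0.
  have : (\sum_(w' | e w0 w') (f w0 - f w') = 0)%R.
    rewrite sumrB harm sumr_const -[(f w0 *+ _)%R]mulr_natl; apply/eqP; rewrite subr_eq0.
    by rewrite -(deg w0) cardsE.
  move/psumr_eq0P => H; apply/eqP; rewrite eq_sym -subr_eq0; apply/eqP.
  by apply: H => // w' _; rewrite subr_ge0; apply: maxw0.
by rewrite -fz; apply: IH => // w' _; rewrite fz; apply: maxw0.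
Qed.

(** * Attaching gadgets to the roots *)

Section Attach.

Variables (t : nat) (W : finType) (e : rel W) (col : W -> bool) (w0 : W).
Hypothesis t_gt1 : 1 < t.
Hypothesis e_sym : symmetric e.
Hypothesis e_irr : irreflexive e.
Hypothesis e_deg : forall w, #|[set w' | e w w']| = 4.
Hypothesis e_conn : forall w w', connect e w w'.

(** In the fibre over [w], [None] is the root and [Some a] is position [a] of its gadget. *)
Definition attach_adj (v v' : W * option 'I_(4 * t).+3) : bool :=
  match v.2, v'.2 with
  | None, None => e v.1 v'.1
  | None, Some a | Some a, None => (v.1 == v'.1) && ports t a
  | Some a, Some a' => (v.1 == v'.1) && gadget t (col v.1) a a'
  end.

Lemma attach_adj_sym : symmetric attach_adj.
Proof.
move=> [w [a|]] [w' [a'|]]; rewrite /attach_adj /=; last exact: e_sym.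
- by rewrite eq_sym; case: eqP => //= ->; rewrite gadget_sym.
- by rewrite eq_sym.
- by rewrite eq_sym.
Qed.

Lemma attach_adj_irr : irreflexive attach_adj.
Proof. by move=> [w [a|]]; rewrite /attach_adj /= ?e_irr // /gadget !eqxx. Qed.

Definition attach : sgraph := SGraph attach_adj_sym attach_adj_irr.

(** General values serve both degrees, with constant 1 in [nat], and kernel equations. *)
Lemma attach_sum_root (V : nmodType) (f : vertex attach -> V) w :
  (\sum_(v | adj ((w, None) : vertex attach) v) f v
   = \sum_(w' | e w w') f (w', None)
     + \sum_(a : 'I_(4 * t).+3 | ports t a) f (w, Some a))%R.
Proof.
rewrite big_pairE; under eq_bigr do rewrite big_mkcond big_optionE.
rewrite big_split /= -big_mkcond; congr (_ + _)%R.
rewrite (bigD1 w) //= [X in (_ + X)%R]big1 ?addr0 => [|w' /negbTE nw].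
  by rewrite -big_mkcond; apply: eq_bigl => a; rewrite /attach_adj /= eqxx.
by apply: big1 => a _; rewrite /attach_adj /= eq_sym nw.
Qed.

Lemma attach_sum_gadget (V : nmodType) (f : vertex attach -> V) w a :
  (\sum_(v | adj ((w, Some a) : vertex attach) v) f v
   = (if ports t a then f (w, None) else 0)
     + \sum_(i : 'I_(4 * t).+3 | gadget t (col w) a i) f (w, Some i))%R.
Proof.
rewrite big_pairE (bigD1 w) //= [X in (_ + X)%R]big1 ?addr0 => [|w' /negbTE nw].
  by rewrite big_mkcond big_optionE /attach_adj /= eqxx /= -big_mkcond.
by apply: big1 => -[i|]; rewrite /= /attach_adj /= eq_sym nw.
Qed.

Lemma attach_regular : regular_graph (4 * t) attach.
Proof.
move=> [w o]; rewrite /degree -sum1dep_card.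
case: o => [a|].
  rewrite [LHS](@attach_sum_gadget nat (fun=> 1)).
  have := gadget_degree t_gt1 (col w) (ltn_ord a).
  rewrite -sum1_card addnC => E; rewrite -[RHS]E; congr (_ + _).
rewrite [LHS](@attach_sum_root nat (fun=> 1)).
have := card_ports t_gt1; rewrite -sum1_card addnC => E; rewrite -[RHS]E; congr (_ + _).
by rewrite -(e_deg w) -sum1dep_card.
Qed.

Lemma card_attach : #|vertex attach| = #|W| * (4 * t).+4.
Proof. by rewrite card_prod card_option card_ord. Qed.

Lemma attach_connected : connected_graph attach.
Proof.
have root w o : connect (@adj attach) (w, o) (w, None).
  case: o => [a|]; last exact: connect0.
  have [k kb /andP[pk gk]] := port_nbr t_gt1 (col w) a.
  apply: (@connect_trans _ _ (w, Some (Ordinal kb))); apply: connect1.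
    by rewrite /= /attach_adj /= eqxx.
  by rewrite /= /attach_adj /= eqxx.
have roots w w' : connect (@adj attach) (w, None) (w', None).
  have /connectP[p pp ->] := e_conn w w'.
  elim: p w pp => [|z p IH] w /=; first by rewrite connect0.
  by case/andP => ez /IH; apply: connect_trans; apply: connect1.
move=> [w o] [w' o'].
have sym : connect_sym (@adj attach) by apply: sym_connect_sym; exact: adj_sym.
apply: connect_trans (root w o) _; apply: connect_trans (roots w w') _.
by rewrite sym.
Qed.

Definition attach_vec (R : nzRingType) (v : vertex attach) : R :=
  if v.2 is Some a then sign R a else 1%R.

Lemma attach_vec_kernel (R : fieldType) : kernel_fun (@attach_vec R).
Proof.
move=> [w [a|]].
  rewrite attach_sum_gadget /attach_vec /= gadget_sign_sum //.
  by case: (ports t a); rewrite ?subrr ?oppr0 ?addr0.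
rewrite attach_sum_root /attach_vec /= sum_ports_sign //.
have -> : (\sum_(w' | e w w') 1 = 4%:R :> R)%R; last by rewrite subrr.
by rewrite sumr_const -(e_deg w) cardsE.
Qed.

(** Subtracting the root value times [sign] leaves a solution of the homogeneous gadget equations,
    which is zero. The ports then contribute -4 times the root value, so the root values are
    harmonic. *)
Lemma attach_kernel_unique (R : realFieldType) (f : vertex attach -> R) :
  kernel_fun f -> exists c, forall v, f v = (c * attach_vec R v)%R.
Proof.
move=> kf.
have fib w a : f (w, Some a) = (f (w, None) * sign R a)%R.
  pose u k := (f (w, Some (inord k)) - f (w, None) * sign R k)%R.
  suff /(_ a (ltn_ord a)) : forall k, k < (4 * t).+3 -> u k = 0%R.
    by rewrite /u inord_val => /eqP; rewrite subr_eq0 => /eqP.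
  apply: (gadget_injective t_gt1 (c := col w)) => k kb.
  have := kf (w, Some (Ordinal kb)); rewrite attach_sum_gadget /= => E.
  rewrite /u; under eq_bigr do rewrite inord_val.
  rewrite sumrB -mulr_sumr gadget_sign_sum // mulrN opprK.
  rewrite -[RHS]E addrC; congr (_ + _)%R.
  by case: (ports t k); rewrite ?mulr1 ?mulr0.
have const w : f (w, None) = f (w0, None).
  apply: (harmonic_const (f := fun w => f (w, None)) e_deg) => // z.
  have := kf (z, None); rewrite attach_sum_root.
  under [X in (_ + X)%R]eq_bigr do rewrite fib.
  rewrite -mulr_sumr sum_ports_sign // => /eqP; rewrite mulrN subr_eq0 => /eqP ->.
  by rewrite mulrC.
exists (f (w0, None)) => -[w [a|]]; first by rewrite fib const.
by rewrite const mulr1.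
Qed.

Lemma attach_nut (R : realFieldType) : nut_graph R attach.
Proof.
apply: (nut_graph_of_fun _ (@attach_vec_kernel R)).
- rewrite card_attach; have : 0 < #|W| by apply/card_gt0P; exists w0.
  by case: #|W| => // n _; rewrite mulSn; lia.
- move=> [w [a|]]; rewrite /attach_vec /= ?oner_eq0 // /sign /parity_fun.
  by case: odd; rewrite ?oppr_eq0 oner_eq0.
- exact: attach_kernel_unique.
Qed.

(** * Recognising gadgets; automorphisms of the attached graph *)

Definition strong_adj (v v' : vertex attach) : bool :=
  adj v v' && (4 * t - 4 <= #|[set z | adj v z && adj v' z]|).

(** Common neighbours of a root and a port are among the other [4 * t - 5] ports; those of two
    adjacent roots are among three roots, and 3 is below [4 * t - 4]. *)
Lemma strong_adjE v v' : strong_adj v v' =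
  if (v.2, v'.2) is (Some a, Some a') then (v.1 == v'.1) && gadget t (col v.1) a a'
  else false.
Proof.
have mixed w (a : 'I_(4 * t).+3) : ports t a ->
    #|[set z | adj ((w, None) : vertex attach) z && adj ((w, Some a) : vertex attach) z]|
      < 4 * t - 4.
  move=> pa; set S := [set z | _].
  pose T := [predD1 [pred i : 'I_(4 * t).+3 | ports t i] & a].
  have cT : 1 + #|T| + 4 = 4 * t.
    by rewrite -[RHS](card_ports t_gt1) (cardD1 a [pred i : 'I_(4 * t).+3 | ports t i]) inE pa.
  suff le : #|S| <= #|[seq ((w, Some i) : vertex attach) | i : 'I_(4 * t).+3 in T]|.
    apply: leq_ltn_trans (leq_trans le (leq_image_card _ _)) _.
    by move: cT; move: #|T| => n; lia.
  apply/subset_leq_card/subsetP => -[w' [i|]]; rewrite inE /= /attach_adj /=.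
    case/andP => /andP[/eqP<- pi] /andP[_ gi]; apply: image_f; rewrite !inE pi andbT.
    by apply: contraTneq gi => ->; rewrite /gadget eqxx.
  by case/andP => ew /andP[/eqP ww _]; rewrite ww e_irr in ew.
rewrite /strong_adj; case: v v' => w [a|] [w' [a'|]] /=; rewrite /attach_adj /=.
- apply: andb_idr => /andP[/eqP<- ga].
  (* Both neighbourhoods have size [4 t] and lie in a fibre of size [4 t + 4]. *)
  pose A := [set z | adj ((w, Some a) : vertex attach) z].
  pose B := [set z | adj ((w, Some a') : vertex attach) z].
  have cA : #|A| = 4 * t by exact: attach_regular.
  have cB : #|B| = 4 * t by exact: attach_regular.
  have cU : #|A :|: B| <= (4 * t).+4.
    have <- : #|[seq ((w, o) : vertex attach) | o : option 'I_(4 * t).+3]| = (4 * t).+4.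
      by rewrite card_image ?card_option ?card_ord // => o o' [].
    apply/subset_leq_card/subsetP => -[x o]; rewrite !inE /= /attach_adj /=.
    by case: o => [i|] /orP[] /andP[/eqP<- _]; apply: image_f.
  have := cardsUI A B; rewrite cA cB.
  have -> : [set z | adj ((w, Some a) : vertex attach) z && adj ((w, Some a') : vertex attach) z]
     = A :&: B by apply/setP => z; rewrite !inE.
  by rewrite /= in cU *; lia.
- apply/negbTE/negP => /andP[/andP[/eqP<- pa]]; apply/negP; rewrite -ltnNge.
  apply: leq_ltn_trans (mixed w a pa); apply: eq_leq.
  by apply: eq_card => z; rewrite !inE andbC.
- apply/negbTE/negP => /andP[/andP[/eqP<- pa]]; apply/negP; rewrite -ltnNge.
  exact: mixed.
apply/negbTE/negP => /andP[ew]; apply/negP; rewrite -ltnNge.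
apply: (@leq_ltn_trans 3); last lia.
have := e_deg w; rewrite (cardsD1 w') inE ew add1n => -[c3].
suff le : #|[set z | adj ((w, None) : vertex attach) z
     && adj ((w', None) : vertex attach) z]|
   <= #|[seq ((x, None) : vertex attach) | x in [set x | e w x] :\ w']|.
  by apply: leq_trans le (leq_trans (leq_image_card _ _) _); rewrite c3.
apply/subset_leq_card/subsetP => -[x [i|]]; rewrite !inE /= /attach_adj /=.
  by case/andP => /andP[/eqP wx _] /andP[/eqP wx' _]; rewrite wx wx' e_irr in ew.
case/andP => ex ex'; apply: image_f; rewrite !inE ex andbT.
by apply: contraTneq ex' => ->; rewrite e_irr.
Qed.

Section AttachAutomorphism.

Variable s : {perm vertex attach}.
Hypothesis s_adj : forall x y, adj (s x) (s y) = adj x y.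

Lemma strong_adj_aut v v' : strong_adj (s v) (s v') = strong_adj v v'.
Proof.
rewrite /strong_adj s_adj; congr (_ && (_ <= _)).
rewrite -[RHS](card_imset _ (@perm_inj _ s)); apply: eq_card => z; rewrite !inE.
apply/idP/imsetP => [h|[x]]; last by rewrite inE => h ->; rewrite !s_adj.
by exists ((s^-1)%g z); rewrite ?permKV // inE -(s_adj v) -(s_adj v') permKV.
Qed.

(** Gadget vertices are exactly those incident with a strong edge. *)
Lemma root_aut v : isSome (s v).2 = isSome v.2.
Proof.
have E x : isSome x.2 = [exists y, strong_adj x y].
  apply/idP/existsP => [|[y]]; last by rewrite strong_adjE; case: x.2.
  case: x => w [a|] //= _.
  have [k kb /andP[_ gk]] := port_nbr t_gt1 (col w) a.
  by exists (w, Some (Ordinal kb)); rewrite strong_adjE /= eqxx.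
rewrite !E; apply/existsP/existsP => -[y hy].
  by exists ((s^-1)%g y); rewrite -strong_adj_aut permKV.
by exists (s y); rewrite strong_adj_aut.
Qed.

(** Composing with [s] stays in the kernel, a line; the scalar is 1 because roots go to roots, where
    the vector is 1. *)
Lemma attach_vec_aut v : attach_vec rat (s v) = attach_vec rat v.
Proof.
have [|c cE] := @attach_kernel_unique rat (fun v => attach_vec rat (s v)).
  move=> x; rewrite -[RHS](attach_vec_kernel rat (s x)).
  rewrite [RHS](reindex_inj (@perm_inj _ s)).
  by apply: eq_bigl => y; rewrite s_adj.
have c1 : c = 1%R.
  have := cE (w0, None); have := root_aut (w0, None); rewrite /attach_vec /= mulr1.
  by case: (s _) => x [].
by rewrite cE c1 mul1r.
Qed.

Lemma attach_aut : exists psi : W -> W,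
  [/\ forall w o, s (w, o) = (psi w, o), forall w, col (psi w) = col w
    & forall w w', e (psi w) (psi w') = e w w'].
Proof.
pose psi w := (s (w, None)).1.
have sN w : s (w, None) = (psi w, None).
  by have := root_aut (w, None); rewrite /psi; case: (s _) => x [].
(* Ports stay adjacent to the image root, and every position has a port neighbour, so gadgets go
   into gadgets. *)
have sS w (a : 'I_(4 * t).+3) : exists a', s (w, Some a) = (psi w, Some a').
  have port (b : 'I_(4 * t).+3) : ports t b -> exists b', s (w, Some b) = (psi w, Some b').
    move=> pb; have := root_aut (w, Some b); have := s_adj (w, None) (w, Some b).
    rewrite sN; case: (s _) => x [b'|] //=.
    by rewrite /attach_adj /= eqxx pb => /andP[/eqP-> _] _; exists b'.
  have [k kb /andP[pk gk]] := port_nbr t_gt1 (col w) a.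
  have [k' sk] := port (Ordinal kb) pk.
  have := root_aut (w, Some a); have := s_adj (w, Some (Ordinal kb)) (w, Some a).
  rewrite sk; case: (s _) => x [a'|] //=.
  have gk' : gadget t (col w) k a by rewrite gadget_sym.
  rewrite /attach_adj /= eqxx gk' => /andP[/eqP-> _] _.
  by exists a'.
have rigid w : col w = col (psi w) /\ forall a, s (w, Some a) = (psi w, Some a).
  (* By [sS] the default 0 is never reached. *)
  pose f k : nat := if (s (w, Some (inord k))).2 is Some a then a else 0.
  have fE a : a < (4 * t).+3 -> s (w, Some (inord a)) = (psi w, Some (inord (f a))).
    by move=> ab; rewrite /f; have [a' ->] := sS w (inord a); rewrite /= inord_val.
  have fb a : a < (4 * t).+3 -> f a < (4 * t).+3.
    by move=> ab; rewrite /f; have [a' ->] := sS w (inord a) => /=.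
  have [|||||cE fid] := @gadget_rigid t t_gt1 (col w) (col (psi w)) f.
  - exact: fb.
  - move=> a a' ab ab' ff; have : s (w, Some (inord a)) = s (w, Some (inord a')).
      by rewrite !fE // ff.
    by move=> /perm_inj[/(congr1 val)]; rewrite /= !inordK.
  - move=> a ab; have := attach_vec_aut (w, Some (inord a)); rewrite fE //.
    rewrite /attach_vec /= !inordK ?fb // /sign /parity_fun.
    by case: odd; case: odd.
  - move=> a ab; have := s_adj (w, None) (w, Some (inord a)); rewrite sN fE //=.
    by rewrite /attach_adj /= !eqxx /= !inordK ?fb.
  - move=> a a' ab ab'; have := s_adj (w, Some (inord a)) (w, Some (inord a')).
    by rewrite !fE //= /attach_adj /= !eqxx /= !inordK ?fb.
  split=> // a; have := fE a (ltn_ord a); rewrite inord_val => ->.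
  by rewrite fid // inord_val.
exists psi; split.
- by move=> w [a|]; [case: (rigid w) | exact: sN].
- by move=> w; case: (rigid w).
- by move=> w w'; have := s_adj (w, None) (w', None); rewrite !sN.
Qed.

End AttachAutomorphism.

End Attach.

(** * The root graph *)

Lemma map_uniq_inj (A B : eqType) (f : A -> B) (s : seq A) :
  uniq (map f s) -> {in s &, injective f}.
Proof.
elim: s => //= z s IH /andP[zs us] x y; rewrite !inE.
move=> /predU1P[->|xs] /predU1P[->|ys] // fxy; last exact: IH us _ _ xs ys fxy.
  by rewrite fxy map_f in zs.
by rewrite -fxy map_f in zs.
Qed.

Section RootGraph.

Variables (gT : finGroupType) (p : nat).
Hypothesis p_ge10 : 10 <= p.

(** Positions beyond the order of the group receive the default voltage 1. *)
Definition voltage (i : 'I_p.+2) : gT := nth 1%g (enum gT) i.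

Lemma voltage_onto x : #|gT| <= p.+2 -> exists i, voltage i = x.
Proof.
move=> p_ge_gT; have ix : index x (enum gT) < p.+2.
  by apply: leq_trans p_ge_gT; rewrite cardE index_mem mem_enum.
by exists (Ordinal ix); rewrite /voltage nth_index ?mem_enum.
Qed.

(** Voltages act on the right, so left translations are automorphisms. *)
Definition step (v w : gT * 'I_p.+2) : bool :=
  ((w.2 == v.2 + 1)%R && (w.1 == v.1))
  || ((w.2 == v.2 + 1 + 1)%R && (w.1 == v.1 * voltage v.2)%g).

Definition root_adj (v w : gT * 'I_p.+2) : bool := step v w || step w v.

Definition mark (i : 'I_p.+2) : bool := (val i) \in [:: 3; 4; 6].

Lemma val_succ (i : 'I_p.+2) : val (i + 1)%R = if val i == p.+1 then 0 else (val i).+1.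
Proof.
rewrite /= modnDmr addn1; case: (nat_of_ord i =P p.+1) => [->|ne]; first by rewrite modnn.
by rewrite modn_small //; have := ltn_ord i; lia.
Qed.

Lemma val_pred (i : 'I_p.+2) : val (i - 1)%R = if val i == 0 then p.+1 else (val i).-1.
Proof.
have : val (i - 1 + 1)%R = val i by rewrite subrK.
by rewrite val_succ; have := ltn_ord (i - 1)%R; rewrite /=; do 2![case: eqP]; lia.
Qed.

(** Cyclic shifts become case distinctions within reach of [lia]. *)
Lemma shift_vals (i : 'I_p.+2) :
  [/\ val (i + 1)%R = if val i == p.+1 then 0 else (val i).+1,
      val (i - 1)%R = if val i == 0 then p.+1 else (val i).-1,
      val (i + 1 + 1)%R = if val (i + 1)%R == p.+1 then 0 else (val (i + 1)%R).+1
    & val (i - 1 - 1)%R = if val (i - 1)%R == 0 then p.+1 else (val (i - 1)%R).-1].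
Proof. by split; rewrite ?val_succ ?val_pred. Qed.

Lemma shifts_uniq (i : 'I_p.+2) : uniq [:: i; i + 1; i - 1; i + 1 + 1; i - 1 - 1]%R.
Proof.
have [] := shift_vals i; rewrite [uniq _]/= !inE -!val_eqE.
move: (i + 1)%R (i - 1)%R (i + 1 + 1)%R (i - 1 - 1)%R (ltn_ord i) => a b c d ip /=.
case: ifP => h1 e1; case: ifP => h2 e2; case: ifP => h3 e3; case: ifP => h4 e4;
  lia.
Qed.

Definition root_nbrs (v : gT * 'I_p.+2) : seq (gT * 'I_p.+2) :=
  let: (g, i) := v in
  [:: (g, i + 1); (g, i - 1); ((g * voltage i)%g, i + 1 + 1);
      ((g * (voltage (i - 1 - 1))^-1)%g, i - 1 - 1)]%R.

Lemma root_adjE v w : root_adj v w = (w \in root_nbrs v).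
Proof.
case: v w => g i [h j]; rewrite /root_adj /step /root_nbrs !inE /= !xpair_eqE.
apply/idP/idP.
  case/orP => /orP[] /andP[/eqP-> /eqP->]; rewrite ?addrK ?mulgK !eqxx ?orbT //.
case/or4P => /andP[/eqP-> /eqP->]; rewrite ?subrK ?mulgKV !eqxx ?orbT //.
Qed.

(** Neighbours lie over distinct positions, so a neighbour is determined by its position. *)
Lemma root_nbrs_uniq v : uniq (map snd (root_nbrs v)).
Proof. by case: v => g i; have /= /andP[] := shifts_uniq i. Qed.

Lemma root_adj_sym : symmetric root_adj.
Proof. by move=> v w; rewrite /root_adj orbC. Qed.

Lemma root_adj_irr : irreflexive root_adj.
Proof.
case=> g i; rewrite root_adjE; apply/negP => /(map_f snd) /=.
by have /= /andP[/negbTE->] := shifts_uniq i.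
Qed.

Lemma root_degree v : #|[set w | root_adj v w]| = 4.
Proof.
rewrite cardsE (eq_card (root_adjE v)) (card_uniqP _); first by case: v.
exact: map_uniq (root_nbrs_uniq v).
Qed.

Lemma root_adj_inj v w w' : root_adj v w -> root_adj v w' -> w.2 = w'.2 -> w = w'.
Proof. by rewrite !root_adjE; apply: (map_uniq_inj (root_nbrs_uniq v)). Qed.

Lemma root_adj_coord v w : root_adj v w ->
  w.2 \in [:: v.2 + 1; v.2 - 1; v.2 + 1 + 1; v.2 - 1 - 1]%R.
Proof. by rewrite root_adjE => /(map_f snd); case: v. Qed.

Lemma root_adj_ex v j : j \in [:: v.2 + 1; v.2 - 1; v.2 + 1 + 1; v.2 - 1 - 1]%R ->
  exists g, root_adj v (g, j).
Proof.
case: v => g i /=.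
rewrite -[[:: _; _; _; _]]/(map snd (root_nbrs (g, i))) => /mapP[[h k] hk /= ->].
by exists h; rewrite root_adjE.
Qed.

Lemma root_adj_ex_to w i : w.2 \in [:: i + 1; i - 1; i + 1 + 1; i - 1 - 1]%R ->
  exists g, root_adj (g, i) w.
Proof.
move=> wi; have [|g] := @root_adj_ex w i; last by rewrite root_adj_sym; exists g.
by move: wi; rewrite !inE => /or4P[] /eqP->; rewrite ?subrK ?addrK ?eqxx ?orbT.
Qed.

(** Steps 1 join all positions with the same group element; a step 2 of voltage [g^-1 * h] leads
    from [g] to [h]. *)
Lemma root_connected v w : #|gT| <= p.+2 -> connect root_adj v w.
Proof.
move=> p_ge_gT; have csym : connect_sym root_adj by apply: sym_connect_sym; exact: root_adj_sym.
have fiber g i : connect root_adj (g, 0%R) (g, i).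
  rewrite -[i]natr_Zp; elim: (nat_of_ord i) => [|k IH]; first exact: connect0.
  apply: connect_trans IH (connect1 _).
  by rewrite /root_adj /step /= -natr1 !eqxx.
have fibers g h i j : connect root_adj (g, 0%R) (h, 0%R) -> connect root_adj (g, i) (h, j).
  move=> gh; apply: connect_trans (fiber h j); apply: connect_trans gh.
  by rewrite csym.
case: v w => g i [h j]; apply: fibers.
have [k ek] := voltage_onto (g^-1 * h)%g p_ge_gT.
apply: connect_trans (fiber g k) _; rewrite csym; apply: connect_trans (fiber h (k + 1 + 1)%R) _.
rewrite csym; apply: connect1.
by rewrite /root_adj /step /= ek mulKVg !eqxx orbT.
Qed.

(** * The marking and the automorphisms preserving it *)

Definition marked_nbrs (i : 'I_p.+2) : nat :=
  mark (i + 1)%R + mark (i - 1)%R + mark (i + 1 + 1)%R + mark (i - 1 - 1)%R.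

Lemma marked_nbrsE v : #|[set w | root_adj v w & mark w.2]| = marked_nbrs v.2.
Proof.
have <- : count (fun w => mark w.2) (root_nbrs v) = marked_nbrs v.2.
  by case: v => g i; rewrite /= /marked_nbrs addn0 !addnA.
rewrite -size_filter -(card_uniqP _); last first.
  by rewrite filter_uniq ?(map_uniq (root_nbrs_uniq v)).
by apply: eq_card => w; rewrite mem_filter inE root_adjE andbC.
Qed.

(** There are at least 12 positions, so neighbourhoods that wrap around gain no marks; beyond 8 the
    default 0 of [nth] is the right count. *)
Lemma marked_nbrs_val i : marked_nbrs i = nth 0 [:: 0; 1; 2; 1; 2; 3; 1; 1; 1] (val i).
Proof.
rewrite /marked_nbrs /mark; have [] := shift_vals i.
move: (i + 1)%R (i - 1)%R (i + 1 + 1)%R (i - 1 - 1)%R (ltn_ord i) => a b c d /=.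
move: (nat_of_ord i) (nat_of_ord a) (nat_of_ord b) (nat_of_ord c) (nat_of_ord d).
have [q -> {i a b c d}] : exists q, p = q.+4.+4.+2 by exists (p - 10); lia.
move=> k a b c d kp ea eb ec ed; have [k1|k1] := leqP k 1.
  by case: k k1 kp ea eb ec ed => [|[|//]] _ _ -> -> -> ->.
have [kq|kq] := ltnP k q.+4.+4.+2; last first.
  have [ek|ek] : k = q.+4.+4.+2 \/ k = q.+4.+4.+3 by lia.
    move: eb ed ec; rewrite ea ek (_ : (q.+4.+4.+2 == q.+4.+4.+3) = false); last lia.
    by rewrite eqxx => -> -> ->.
  by move: eb ed ec; rewrite ea ek eqxx => -> -> ->.
move: eb ed ec; rewrite ea (_ : (k == q.+4.+4.+3) = false); last lia.
rewrite (_ : (k.+1 == q.+4.+4.+3) = false); last lia.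
case: k k1 kp kq ea => [|[|k]] // _ _ _ _ -> -> -> /=.
by do 7![case: k => [//|k]]; rewrite /= nth_nil.
Qed.

Lemma marked_nbrs_two i : ~~ mark i -> marked_nbrs i = 2 -> val i = 2.
Proof.
rewrite marked_nbrs_val /mark.
by case: (val i) => [|[|[|[|[|[|[|[|[|k]]]]]]]]] //=; rewrite nth_nil.
Qed.

Lemma shifts_of_two (i j : 'I_p.+2) :
    val i = 2 -> j \in [:: i + 1; i - 1; i + 1 + 1; i - 1 - 1]%R -> val j < 5.
Proof.
rewrite !inE -!val_eqE; have [] := shift_vals i.
move: (i + 1)%R (i - 1)%R (i + 1 + 1)%R (i - 1 - 1)%R (ltn_ord i) => a b c d ip /=.
case: ifP => h1 e1; case: ifP => h2 e2; case: ifP => h3 e3; case: ifP => h4 e4; lia.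
Qed.

Lemma small_marks (i j : 'I_p.+2) : val i < 5 -> val j < 5 ->
  mark i = mark j -> marked_nbrs i = marked_nbrs j -> val i != 2 -> val j != 2 -> i = j.
Proof.
move=> i5 j5; rewrite !marked_nbrs_val /mark => mij nij i2 j2; apply: val_inj.
move: i5 j5 mij nij i2 j2; move: (val i) (val j) => k l.
by case: k => [|[|[|[|[|k]]]]] //; case: l => [|[|[|[|[|l]]]]].
Qed.

Section ColouredAutomorphism.

Variable psi : gT * 'I_p.+2 -> gT * 'I_p.+2.
Hypothesis psi_inj : injective psi.
Hypothesis psi_adj : forall v w, root_adj (psi v) (psi w) = root_adj v w.
Hypothesis psi_mark : forall v, mark (psi v).2 = mark v.2.

Lemma marked_nbrs_aut v : marked_nbrs (psi v).2 = marked_nbrs v.2.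
Proof.
rewrite -!marked_nbrsE -[RHS](card_imset _ psi_inj); apply: eq_card => w.
have [psiV psiK psiVK] := injF_bij psi_inj.
rewrite !inE; apply/idP/imsetP => [|[u]]; last by rewrite inE => h ->; rewrite psi_adj psi_mark.
by rewrite -[w]psiVK psi_adj psi_mark => h; exists (psiV w); rewrite ?inE.
Qed.

(* 2 is the only unmarked position with two marked neighbours, and its neighbours
   0, 1, 3, 4 are told apart by their mark and number of marked neighbours. *)
Lemma coord_aut_seed g i : val i < 4 -> (psi (g, i)).2 = i.
Proof.
have coord2 h j : val j = 2 -> (psi (h, j)).2 = j.
  move=> j2; apply: val_inj; rewrite j2; apply: marked_nbrs_two.
    by rewrite psi_mark /mark /= -[nat_of_ord j]/(val j) j2.
  by rewrite marked_nbrs_aut marked_nbrs_val /= -[nat_of_ord j]/(val j) j2.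
move=> i4; have [/coord2//|i2] := eqVneq (val i) 2.
have [two two2] : exists j : 'I_p.+2, val j = 2.
  have lt2 : 2 < p.+2 by lia.
  by exists (Ordinal lt2).
have itwo : i \in [:: two + 1; two - 1; two + 1 + 1; two - 1 - 1]%R.
  rewrite !inE -!val_eqE; have [] := shift_vals two.
  move: i4 i2 two2 (two + 1)%R (two - 1)%R (two + 1 + 1)%R (two - 1 - 1)%R => /= i4 i2 two2 a b c d.
  case: ifP => h1 e1; case: ifP => h2 e2; case: ifP => h3 e3; case: ifP => h4 e4; lia.
have [h hi] := @root_adj_ex_to (g, i) two itwo.
have := hi; rewrite -psi_adj => /root_adj_coord; rewrite (coord2 h two two2).
move=> /(shifts_of_two two2) lt5.
apply: small_marks => //; rewrite ?psi_mark ?marked_nbrs_aut //.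
  by rewrite ltnW.
apply: contra_neq i2 => e2; apply: marked_nbrs_two.
  by rewrite -(psi_mark (g, i)) /mark e2.
by rewrite -(marked_nbrs_aut (g, i)) marked_nbrs_val e2.
Qed.

(* The last neighbour of [i] is identified once the other three are. *)
Lemma coord_aut_step i :
    (forall g, (psi (g, i - 1 - 1)%R).2 = (i - 1 - 1)%R) ->
    (forall g, (psi (g, i - 1)%R).2 = (i - 1)%R) ->
    (forall g, (psi (g, i)).2 = i) ->
    (forall g, (psi (g, i + 1)%R).2 = (i + 1)%R) ->
  forall g, (psi (g, i + 1 + 1)%R).2 = (i + 1 + 1)%R.
Proof.
move=> P2 P1 P0 S1 h.
have [|g gh] := @root_adj_ex_to (h, i + 1 + 1)%R i; first by rewrite !inE eqxx !orbT.
have gh' := gh; rewrite -psi_adj in gh'.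
(* The neighbour of [(g, i)] over [j] already has its image over [j], and [psi (g, i)] has only one
   neighbour there. *)
have other j : j \in [:: i + 1; i - 1; i + 1 + 1; i - 1 - 1]%R -> j != (i + 1 + 1)%R ->
    (forall g, (psi (g, j)).2 = j) -> (psi (h, i + 1 + 1)%R).2 <> j.
  move=> ji jn Pj E; have [x gx] := @root_adj_ex (g, i) j ji.
  have gx' := gx; rewrite -psi_adj in gx'.
  have := root_adj_inj gh' gx'; rewrite E Pj => /(_ erefl) /psi_inj[_ /esym jE].
  by rewrite jE eqxx in jn.
have := shifts_uniq i; rewrite /= !inE !negb_or.
case/and5P => [_ /and3P[_ n1 _] /andP[n2 _] n3 _].
have := root_adj_coord gh'; rewrite P0 !inE => /or4P[] /eqP E //.
- by case: (other _ _ _ S1 E); rewrite ?inE ?eqxx.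
- by case: (other _ _ _ P1 E); rewrite ?inE ?eqxx ?orbT.
- by case: (other _ _ _ P2 E); rewrite ?inE ?eqxx ?orbT // eq_sym.
Qed.

(** Induction around the cycle carries four consecutive fixed positions, starting from 0, 1, 2,
    3. *)
Lemma coord_aut g i : (psi (g, i)).2 = i.
Proof.
pose P i := forall g, (psi (g, i)).2 = i.
suff Q k : [/\ P k%:R, P k.+1%:R, P k.+2%:R & P k.+3%:R]%R.
  by have [+ _ _ _] := Q (val i); rewrite natr_Zp => /(_ g).
elim: k => [|k [P0 P1 P2 P3]].
  by split=> h; apply: coord_aut_seed; rewrite Zp_nat /= modn_small; lia.
split=> //; have e j : (j.+1%:R - 1 = j%:R :> 'I_p.+2)%R by rewrite -natr1 addrK.
rewrite /P -[(k.+4%:R)%R]natr1 -[(k.+3%:R)%R]natr1.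
by apply: coord_aut_step; rewrite ?e ?natr1.
Qed.

(** Trivial voltages on steps 1 make the group part of [psi (g, i)] independent of [i]; a step 2 of
    voltage [g] from the identity shows that it is its value at the identity times [g]. *)
Lemma coloured_aut : #|gT| <= p.+2 ->
  exists k : gT, forall g i, psi (g, i) = ((k * g)%g, i).
Proof.
move=> p_ge_gT; have psiE g i : psi (g, i) = ((psi (g, i)).1, i).
  by rewrite [LHS]surjective_pairing coord_aut.
have up g i : (psi (g, i + 1)%R).1 = (psi (g, i)).1.
  have h : root_adj (g, i) (g, i + 1)%R by rewrite /root_adj /step /= !eqxx.
  rewrite -psi_adj in h.
  suff h' : root_adj (psi (g, i)) ((psi (g, i)).1, i + 1)%R.
    by have := root_adj_inj h h'; rewrite coord_aut => /(_ erefl) ->.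
  by rewrite /root_adj /step /= coord_aut !eqxx.
have base g i : (psi (g, i)).1 = (psi (g, 0%R)).1.
  rewrite -[i]natr_Zp; elim: (nat_of_ord i) => [//|k IH].
  by rewrite -natr1 up.
exists (psi (1%g, 0%R)).1 => g i; rewrite psiE base; congr (_, _).
have [k <-] := voltage_onto g p_ge_gT.
have h : root_adj (1%g, k) (voltage k, k + 1 + 1)%R by rewrite /root_adj /step /= mul1g !eqxx orbT.
rewrite -psi_adj in h.
suff h' : root_adj (psi (1%g, k)) (((psi (1%g, k)).1 * voltage k)%g, k + 1 + 1)%R.
  have := root_adj_inj h h'; rewrite coord_aut => /(_ erefl) E.
  by rewrite -(base _ (k + 1 + 1)%R) E /= base.
by rewrite /root_adj /step /= coord_aut !eqxx orbT.
Qed.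

End ColouredAutomorphism.

End RootGraph.

(** * The nut graphs of a given group *)

Section GroupGraph.

Variables (gT : finGroupType) (t n : nat).
Hypothesis t_gt1 : 1 < t.

(** The summand 10 makes room for the marking, [#|gT|] for all voltages, and [n] yields infinitely
    many orders. *)
Let p := 10 + #|gT| + n.

Let p_ge10 : 10 <= p. Proof. by rewrite /p; lia. Qed.
Let p_ge_gT : #|gT| <= p.+2. Proof. by rewrite /p; lia. Qed.

Definition nut_for_group : sgraph :=
  attach (fun v : gT * 'I_p.+2 => mark v.2) t_gt1 (@root_adj_sym gT p)
    (@root_adj_irr gT p p_ge10).

Lemma card_nut_for_group :
  #|vertex nut_for_group| = #|gT| * (12 + #|gT| + n) * (4 * t).+4.
Proof. by rewrite card_attach card_prod card_ord. Qed.

Lemma nut_for_group_connected : connected_graph nut_for_group.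
Proof. by apply: attach_connected => v w; apply: root_connected. Qed.

Lemma nut_for_group_regular : regular_graph (4 * t) nut_for_group.
Proof. by apply: attach_regular; exact: root_degree. Qed.

Lemma nut_for_group_nut (R : realFieldType) : nut_graph R nut_for_group.
Proof.
apply: attach_nut; [exact: (1%g, 0%R) | exact: root_degree | by move=> v w; apply: root_connected].
Qed.

(* Permutations compose from left to right, whence the inverse. *)
Definition left_mul (k : gT) (v : vertex nut_for_group) : vertex nut_for_group :=
  let: ((g, i), o) := v in (((k^-1 * g)%g, i), o).

Lemma left_mul_inj k : injective (left_mul k).
Proof. by move=> [[g i] o] [[h j] o'] [/mulgI-> -> ->]. Qed.

Definition left_perm (k : gT) : {perm vertex nut_for_group} := perm (@left_mul_inj k).

Lemma left_permM : {in [set: gT] &, {morph left_perm : k l / (k * l)%g}}.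
Proof.
move=> k l _ _; apply/permP => -[[g i] o].
by rewrite permM !permE /= invMg mulgA.
Qed.

Canonical left_morphism := Morphism left_permM.

Lemma left_perm_aut k : left_perm k \in graph_aut nut_for_group.
Proof.
apply/graph_autP => -[[g i] o] [[h j] o']; rewrite !permE /=.
rewrite /attach_adj /=; case: o o' => [a|] [b|]; rewrite ?xpair_eqE ?(inj_eq (mulgI _)) //.
by rewrite /root_adj /step /= -!mulgA !(inj_eq (mulgI _)).
Qed.

(** Left translations embed the group; they exhaust the automorphisms by [attach_aut] followed by
    [coloured_aut]. *)
Lemma nut_for_group_aut : graph_aut nut_for_group \isog [set: gT].
Proof.
rewrite isog_sym.
have inj : ('injm left_morphism)%g.
  apply/injmP => k l _ _ /permP/(_ ((1%g, 0%R), None)).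
  by rewrite !permE /= !mulg1 => -[/invg_inj].
suff E : (left_morphism @* [set: gT])%g = graph_aut nut_for_group.
  by rewrite /= -E; apply: sub_isog.
apply/setP => s; apply/morphimP/idP => [[k _ _ ->]|/graph_autP sadj].
  exact: left_perm_aut.
have [psi [sE psi_mark psi_adj]] :=
  attach_aut (1%g, 0%R) (@root_degree gT p p_ge10) (fun v w => root_connected v w p_ge_gT) sadj.
have psi_inj : injective psi.
  move=> v w vw; have : s (v, None) = s (w, None) by rewrite !sE vw.
  by move=> /perm_inj[].
have [k kE] := coloured_aut p_ge10 psi_inj psi_adj psi_mark p_ge_gT.
exists (k^-1)%g; rewrite ?inE //; apply/permP => -[[g i] o].
by rewrite sE kE permE /= invgK.
Qed.

End GroupGraph.

Theorem theorem2 (R : realType) (gT : finGroupType) (K : {group gT}) (d : nat)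
    (hd : d \in [:: 8; 12; 16; 20; 24]) :
  exists G : nat -> sgraph,
    (forall n, [/\ connected_graph (G n), regular_graph d (G n), nut_graph R (G n)
                 & graph_aut (G n) \isog K]) /\
    (forall m n, m <> n -> ~ graph_iso (G m) (G n)).
Proof.
have [t t_gt1 ->] : exists2 t, 1 < t & d = 4 * t.
  by move: hd; rewrite !inE => /or4P[|||/orP[]] /eqP->;
     [exists 2|exists 3|exists 4|exists 5|exists 6].
(* [subg_of K] makes the subgroup [K] a group type of its own. *)
exists (fun n => nut_for_group (subg_of K) n t_gt1); split=> [n|m n mn [f [fbij _]]].
  split.
  - exact: nut_for_group_connected.
  - exact: nut_for_group_regular.
  - exact: nut_for_group_nut.
  - apply: isog_trans (nut_for_group_aut _ _ _) _.
    by rewrite isog_sym; apply: isog_subg.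
(* The number of vertices is strictly increasing in the index. *)
have := bij_eq_card fbij; rewrite !card_nut_for_group => /eqP.
rewrite eqn_pmul2r // eqn_pmul2l; last by apply/card_gt0P; exists 1%g.
by rewrite eqn_add2l => /eqP.
Qed.
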